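(* Let $R$ be a prime ring, $A$ an integrally closed subring of the center of $R$ whose fraction field $F$ has characteristic $0$, with $R$ a finitely generated $A$-module, and let $n=[R:A]$. If $\tau:R\to A$ is any trace (with values in $A$) for which $R$ is an $m$-Cayley–Hamilton algebra, then there is a positive integer $r$ such that $m=rn$ and $\tau=r\,t_{R/A}$.
   Context: $S=R\otimes_AF\cong M_k(D)$, $D$ a division ring with center $Z$, $\dim_ZD=h^2$, $p=[Z:F]$; $[R:A]:=hkp$; the reduced trace $t_{R/A}$ is the restriction to $R$ of $t_{S/F}(a)=\frac{1}{hk}\operatorname{tr}_F(L_a)$, $L_a$ left multiplication by $a$ on $S$ (it takes values in $A$). A trace on $R$ with values in $A$ is an $A$-linear map $\tau:R\to A$ with $\tau(ab)=\tau(ba)$ (and $\tau(\tau(a)b)=\tau(a)\tau(b)$). $R$ is $m$-Cayley–Hamilton for $\tau$ if $\tau(1)=m$ and $\chi^m_a(a)=0$ for all $a$, where $\chi^m_a(x)=x^m+\sum_{i=1}^mP_i(\tau(a),\dots,\tau(a^i))x^{m-i}$ with $P_i$ the universal rational polynomials expressing elementary symmetric functions via power sums. *)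

(* Defs.v *)
From HB Require Import structures.
From mathcomp Require Import all_boot all_order all_algebra all_field.
Set Implicit Arguments. Unset Strict Implicit. Unset Printing Implicit Defensive.
Import Order.TTheory GRing.Theory.
Local Open Scope ring_scope.

Definition prime_ring (R : nzRingType) : Prop :=
  forall a b : R, (forall x : R, a * x * b = 0) -> a = 0 \/ b = 0.

Definition integrally_closed (A : idomainType) : Prop :=
  forall x : {fraction A},
    (exists2 q : {poly A}, q \is monic & root (map_poly (@tofrac A) q) x) ->
    exists a : A, x = tofrac a.

(* Elementary symmetric functions e_0,...,e_n expressed through power sums
   p_1, p_2, ... by Newton's identities  i e_i = sum_{j=1}^i (-1)^(j-1) e_(i-j) p_j. *)
Fixpoint esym_seq (F : fieldType) (p : nat -> F) (n : nat) : seq F :=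
  match n with
  | 0 => [:: 1]
  | n'.+1 => let s := esym_seq p n' in
      rcons s ((n'.+1)%:R^-1 *
               \sum_(j < n'.+1) (-1) ^+ j * nth 0 s (n' - j) * p j.+1)
  end.
Definition esym_of_psum (F : fieldType) (p : nat -> F) (i : nat) : F :=
  nth 0 (esym_seq p i) i.

Definition P_coef (F : fieldType) (p : nat -> F) (i : nat) : F :=
  (-1) ^+ i * esym_of_psum p i.

(* chi^m_a(a) evaluated in the F-algebra S, for a in S and power sums p_i = tau(a^i). *)
Definition chi_eval (F : fieldType) (S : falgType F) (m : nat) (p : nat -> F) (a : S) : S :=
  a ^+ m + \sum_(i < m) P_coef p i.+1 *: a ^+ (m - i.+1).

(* S = R (x)_A F is a finite dimensional F-algebra: dim_F S, p = [Z:F] with Z the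
   center, hk = sqrt(dim_Z S). *)
Definition center_dim (F : fieldType) (S : falgType F) : nat := \dim ('Z(fullv : {vspace S}))%VS.
Definition hk_deg (F : fieldType) (S : falgType F) : nat :=
  Nat.sqrt (\dim (fullv : {vspace S}) %/ center_dim S).
Definition RA_degree (F : fieldType) (S : falgType F) : nat := (hk_deg S * center_dim S)%N.
Definition reduced_trace (F : fieldType) (S : falgType F) (a : S) : F :=
  (hk_deg S)%:R^-1 * \tr (passmx.mxof (vbasis {:S}) (vbasis {:S}) (amull a)).

(* Main.v *)
Require Import Defs.
From HB Require Import structures.
From Stdlib Require Import Classical_Prop.
From mathcomp Require Import all_boot all_order all_algebra all_field ring.
Set Implicit Arguments. Unset Strict Implicit. Unset Printing Implicit Defensive.
Import GRing.Theory.
Local Open Scope ring_scope.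

(* Let S be the algebra over F in which R is an order; tau extends to S. For a
   Cayley-Hamilton trace the value at a nonzero idempotent is nonzero, hence
   radicals of tau are trivial and the form tau(xy) is nondegenerate; the
   regular trace of S is then x |-> tau(c x), with c = sum_i s_i t_i the Casimir
   element of a pair of dual bases of S.

   If K is a commutative subfield of S, possibly with unit an idempotent e, let
   z generate K over F with minimal polynomial mu, and write chi = mu^q h for
   the polynomial chi with chi' / chi = sum_i tau(z^i) x^(-i-1) that
   annihilates z. Comparing chi' with the trace of (chi(x) - chi(z)) / (x - z)
   gives tau = q Tr_(K/F) on K with q > 0 an integer: in terms of dual bases of
   K, sum_j a_j b_j = e / q.

   Apply this to the center Z (with integer p in place of q) and to a maximal
   subfield K of e S e, for e an idempotent such that e S e is a division
   algebra. Evaluating sum_(i, j) tau(z t_i a_j s_i b_j) for z in Z in two ways,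
   by the averaging operator x |-> sum_j a_j x b_j onto K, respectively by
   x |-> sum_i t_i x s_i onto Z, yields tau(z e) / q^2 = tau(z c e) / p for all
   z in Z, so that c = p / q^2. Since m = tau(1) = p [Z : F], comparing
   dimensions gives dim S = (p / q)^2 [Z : F], so p / q is the integer hk, and
   tau is q times the reduced trace. *)

(** * Newton identities *)

Section NewtonIdentities.

Variables (F : fieldType) (p : nat -> F).

Lemma size_esym_seq n : size (esym_seq p n) = n.+1.
Proof. by elim: n => //= n IHn; rewrite size_rcons IHn. Qed.

Lemma nth_esym_seq n i :
  (i <= n)%N -> nth 0 (esym_seq p n) i = esym_of_psum p i.
Proof.
elim: n => [|n IHn]; first by case: i.
rewrite leq_eqVlt => /predU1P[-> //|lt_i_n]; rewrite -IHn //=.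
by rewrite nth_rcons size_esym_seq lt_i_n.
Qed.

Lemma P_coef0 : P_coef p 0 = 1.
Proof. exact: mul1r. Qed.

Hypothesis char0 : [pchar F] =i pred0.

(** Newton's recursion with the signs absorbed into [P_coef]. The right side carries the factor k
    because the sum is later compared with the coefficients of a derivative. *)
Lemma newton_P_coef k :
  \sum_(l < k) P_coef p l * p (k - l)%N = - (k%:R * P_coef p k).
Proof.
case: k => [|k]; first by rewrite big_ord0 mul0r oppr0.
have k_neq0 : k.+1%:R != 0 :> F by move/pcharf0P: char0 => ->.
rewrite {2}/P_coef /esym_of_psum /= nth_rcons size_esym_seq ltnn eqxx.
rewrite mulrCA mulVKf // exprS mulN1r mulNr opprK mulr_sumr.
rewrite (reindex_inj rev_ord_inj) /=; apply: eq_bigr => j _.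
have le_jk : (j <= k)%N by rewrite -ltnS.
rewrite subSS nth_esym_seq ?leq_subr // subSn ?leq_subr // subKn //.
by rewrite /P_coef !mulrA -signr_odd oddB // signr_addb !signr_odd.
Qed.

End NewtonIdentities.

(** * The tracial characteristic polynomial *)

Section CharacteristicPolynomial.

Variable F : fieldType.

Definition tracial_char_poly (m : nat) (p : nat -> F) : {poly F} :=
  \poly_(i < m.+1) P_coef p (m - i).

Lemma tracial_char_poly_neq0 m p : tracial_char_poly m p != 0.
Proof.
by apply/eqP => /polyP/(_ m)/eqP; rewrite coef_poly ltnSn subnn P_coef0 coef0 oner_eq0.
Qed.

Lemma chi_evalE (S : falgType F) m p (a : S) :
  chi_eval m p a = \sum_(k < m.+1) P_coef p k *: a ^+ (m - k).
Proof. by rewrite /chi_eval big_ord_recl P_coef0 scale1r subn0. Qed.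

Lemma horner_tracial_char_poly (S : falgType F) m p (a : S) :
  (map_poly (in_alg S) (tracial_char_poly m p)).[a] = chi_eval m p a.
Proof.
rewrite (@horner_coef_wide _ m.+1); last first.
  by rewrite (leq_trans (size_poly _ _)) ?size_poly.
rewrite chi_evalE [RHS](reindex_inj rev_ord_inj) /=; apply: eq_bigr => i _.
by rewrite coef_map coef_poly ltn_ord /= mulr_algl subSS subKn // -ltnS.
Qed.

End CharacteristicPolynomial.

(** * Fractions and homogeneity *)

Lemma fraction_quotient (A : idomainType) (k : {fraction A}) :
  exists n d : A, d != 0 /\ k = tofrac n / tofrac d.
Proof.
exists (frac (repr k)).1, (frac (repr k)).2; rewrite denom_ratioP; split=> //.
set x := repr k.
have d_neq0 := denom_ratioP x.
apply: (canRL (mulfK _)); first by rewrite tofrac_eq0.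
rewrite -[k]reprK -/x; unlock tofrac; rewrite -[_ * _]/(FracField.mul _ _) !piE.
apply/eqmodP; rewrite /= equivfE /FracField.mulf.
by rewrite !numden_Ratio ?mulr1 ?oner_neq0 // mulrC.
Qed.

(** With the i-th power sum in weight i, Newton's recursion is homogeneous of weight k. This is what
    clears denominators when the Cayley-Hamilton identity passes from R to S. *)
Lemma P_coef_homogeneous (F : fieldType) (p : nat -> F) (c : F) k :
    [pchar F] =i pred0 ->
  P_coef (fun i => c ^+ i * p i) k = c ^+ k * P_coef p k.
Proof.
move=> char0; elim/ltn_ind: k => -[|k] IHk; first by rewrite !P_coef0 mul1r.
have k_neq0 : k.+1%:R != 0 :> F by move/pcharf0P: char0 => ->.
apply/(mulfI k_neq0)/oppr_inj; rewrite [in RHS]mulrCA -[RHS]mulrN -!newton_P_coef // mulr_sumr.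
apply: eq_bigr => l _; rewrite IHk // mulrACA -exprD subnKC //.
exact: ltnW.
Qed.

Lemma chi_eval_homogeneous (F : fieldType) (S : falgType F) m (p : nat -> F) (c : F)
    (x : S) : [pchar F] =i pred0 ->
  chi_eval m (fun i => c ^+ i * p i) (c *: x) = c ^+ m *: chi_eval m p x.
Proof.
move=> char0; rewrite !chi_evalE scaler_sumr; apply: eq_bigr => k _.
rewrite P_coef_homogeneous // exprZn !scalerA; congr (_ *: _).
by rewrite mulrAC -exprD subnKC // -ltnS.
Qed.

Lemma eq_P_coef (F : fieldType) (p p' : nat -> F) k :
    [pchar F] =i pred0 -> p =1 p' -> P_coef p k = P_coef p' k.
Proof.
move=> char0 eq_p; elim/ltn_ind: k => -[|k] IHk; first by rewrite !P_coef0.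
have k_neq0 : k.+1%:R != 0 :> F by move/pcharf0P: char0 => ->.
apply/(mulfI k_neq0)/oppr_inj; rewrite -!newton_P_coef //.
by apply: eq_bigr => l _; rewrite IHk // eq_p.
Qed.

(** Stated for any F-module because it serves twice: for fractions in S and for the values of the
    trace, F being a module over itself. *)
Lemma common_denominator (F : fieldType) (V : lmodType F) (n v d d' : F) (x y : V) :
    v != 0 -> d != 0 -> d' != 0 ->
  (n / v) *: (d^-1 *: x) + d'^-1 *: y
    = (v * d * d')^-1 *: ((n * d') *: x + (v * d) *: y).
Proof.
move=> v0 d0 d'0; rewrite scalerDr !scalerA.
by congr (_ *: _ + _ *: _); field; rewrite ?v0 ?d0 ?d'0.
Qed.

(** * Cayley-Hamilton traces on subfields *)

Section DividedDifference.

Variables (F : fieldType) (L : fieldExtType F) (z : L) (rho : {scalar L}).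

Local Notation "f ^L" := (map_poly (in_alg L) f).
Local Notation rhoP := (map_poly rho).

(* For a root [z] of [f] this is (f(x) - f(z)) / (x - z). *)
Definition divdiff (f : {poly F}) : {poly L} := f^L %/ ('X - z%:P).

Lemma divdiffK f : root f^L z -> divdiff f * ('X - z%:P) = f^L.
Proof. by move=> fz; rewrite divpK // dvdp_XsubCl. Qed.

Lemma divdiff_unique f q : q * ('X - z%:P) = f^L -> q = divdiff f.
Proof. by rewrite /divdiff => <-; rewrite mulpK ?polyXsubC_eq0. Qed.

Lemma divdiffM f g : root f^L z -> divdiff (f * g) = g^L * divdiff f.
Proof.
move=> fz; apply/esym/divdiff_unique.
by rewrite -mulrA divdiffK // rmorphM mulrC.
Qed.

Lemma horner_divdiff f : root f^L z -> (divdiff f).[z] = (f^`()^L).[z].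
Proof.
move=> fz; rewrite -deriv_map -[in RHS]divdiffK // derivM derivXsubC.
by rewrite !hornerE subrr mulr0 add0r.
Qed.

Lemma size_divdiff f : size (divdiff f) = (size f).-1.
Proof. by rewrite size_divp ?polyXsubC_eq0 // size_XsubC size_map_poly subn1. Qed.

Lemma size_map_divdiff f : (size (rhoP (divdiff f)) <= (size f).-1)%N.
Proof. by rewrite -size_divdiff size_poly. Qed.

Lemma map_scalarM (f : {poly F}) (q : {poly L}) : rhoP (f^L * q) = f * rhoP q.
Proof.
apply/polyP => i; rewrite coef_map /= !coefM linear_sum; apply: eq_bigr => k _.
by rewrite !coef_map /= mulr_algl linearZ.
Qed.

(** Since x - z divides g(x) - g(z) and [divdiff f] times x - z is f, the scalar g(z) may be traded
    for the polynomial g modulo f, and [rho] commutes with multiplication by polynomials over F. *)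
Lemma map_scalarC_divdiff (f g : {poly F}) : root f^L z ->
  exists h, rhoP ((g^L).[z] *: divdiff f) = g * rhoP (divdiff f) - h * f.
Proof.
move=> fz; have: root (g^L - (g^L).[z]%:P) z by rewrite /root !hornerE subrr.
rewrite -dvdp_XsubCl => /dvdpP[h gh]; exists (rhoP h).
have -> : (g^L).[z] *: divdiff f = g^L * divdiff f - f^L * h.
  by rewrite -mul_polyC -[f^L]divdiffK // -mulrA [_ * h]mulrC -gh; ring.
rewrite -map_scalarM [_ * f]mulrC -map_scalarM.
by apply/polyP => i; rewrite coefB !coef_map -linearB -coefB.
Qed.

(* [kappa] accounts for [rho 1] differing from the power sum [p 0 = m]. *)
Lemma map_divdiff_newton (m : nat) (c : nat -> F) (kappa : F) :
    let chi := \poly_(i < m.+1) c (m - i)%N in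
    root chi^L z -> rho 1 = m%:R - kappa ->
    (forall k, \sum_(l < k) c l * rho (z ^+ (k - l)) = - (k%:R * c k)) ->
  'X * rhoP (divdiff chi) = 'X * chi^`() - kappa *: chi.
Proof.
move=> chi chi_z rho1 newton.
(* Horner's scheme: [d k] is the coefficient of degree m - k - 1 in the quotient of [chi] by x - z,
   and [d m], the remainder, is chi(z) = 0. *)
pose d k := \sum_(l < k.+1) c l *: z ^+ (k - l).
have dS k : d k.+1 = (c k.+1)%:A + d k * z.
  rewrite /d big_ord_recr /= subnn expr0 addrC; congr (_ + _).
  rewrite mulr_suml; apply: eq_bigr => l _.
  by rewrite -scalerAl -exprSr subSn // -ltnS.
have rho_d k : rho (d k) = (m%:R - k%:R - kappa) * c k.
  rewrite /d big_ord_recr /= subnn expr0 linearD linearZ /= rho1 linear_sum /=.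
  under eq_bigr => l _ do rewrite linearZ /=.
  by rewrite newton; ring.
have dm : d m = 0.
  rewrite -(rootP chi_z) (@horner_coef_wide _ m.+1); last first.
    by rewrite size_map_poly size_poly.
  rewrite [RHS](reindex_inj rev_ord_inj) /=; apply: eq_bigr => l _.
  by rewrite coef_map coef_poly subSS ltnS leq_subr mulr_algl subKn // -ltnS.
have <- : \poly_(i < m) d (m - i.+1)%N = divdiff chi.
  apply: divdiff_unique; apply/polyP => i.
  rewrite mulrBr coefB coefMX coefMC !coef_map !coef_poly.
  case: i => [|i] /=.
    rewrite subn0 subn1; case: (m) dm => [|k] dk.
      by rewrite mul0r subr0; move: dk; rewrite /d big_ord1 subnn expr0.
    by apply/eqP; rewrite sub0r eq_sym -addr_eq0 -dS dk.
  rewrite ltnS; case: ltnP => [lt_i_m|le_m_i]; last first.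
    by rewrite ltnNge ltnW // mul0r subr0 scale0r.
  case: ltnP => [lt_i1_m|le_m_i1].
    by rewrite -subnSK // dS addrK.
  have -> : m = i.+1 by apply/eqP; rewrite eqn_leq le_m_i1.
  by rewrite subnn mul0r subr0 /d big_ord1 subnn expr0.
apply/polyP => i; rewrite coefB !coefXM coefZ coef_map coef_deriv !coef_poly.
case: i => [|i] /=.
  rewrite sub0r subn0; apply/eqP; rewrite eq_sym oppr_eq0; apply/eqP.
  by have /eqP := rho_d m; rewrite dm linear0 subrr sub0r mulNr eq_sym oppr_eq0 => /eqP.
rewrite ltnS; case: ltnP => [lt_i_m|le_m_i].
  by rewrite rho_d natrB // opprB [m%:R + _]addrC subrK mulrBl mulr_natl.
by rewrite linear0 mul0rn mulr0 subr0.
Qed.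

End DividedDifference.

Section PrimitiveElement.

Variables (F : fieldType) (L : fieldExtType F).
Hypothesis char0 : [pchar F] =i pred0.

Local Notation "f ^L" := (map_poly (in_alg L) f).

(** A nonzero generator makes its minimal polynomial coprime to X. If the separable generator is 0
    then L = F, and 1 generates. *)
Lemma nonzero_primitive_element : exists2 z : L, z != 0 & {:L}%VS = <<1; z>>%VS.
Proof.
have pcharL0 : [pchar L] =i pred0.
  by move=> p; rewrite -(char0 p) (fmorph_pchar (in_alg L)).
have genL : {:L}%VS = <<1; separable_generator 1 {:L}>>%VS.
  apply: (eq_adjoin_separable_generator (E := {:L}%AS)); last exact: subvf.
  by apply/separableP => y _; apply: pcharf0_separable.
have [z0|z_neq0] := eqVneq (separable_generator 1 {:L}%AS) 0; last first.
  by exists (separable_generator 1 {:L}).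
exists 1; first exact: oner_neq0.
by rewrite genL z0 (Fadjoin0 1%AS) (Fadjoin_idP (mem1v 1%AS)).
Qed.

Lemma primitive_min_poly : exists (z : L) (mu : {poly F}),
  [/\ z != 0, irreducible_poly mu, size mu = (\dim {:L}).+1,
      forall f, root f^L z = (mu %| f) & forall y, exists f, y = f^L.[z]].
Proof.
have [z z_neq0 genL] := nonzero_primitive_element.
have /polyOver1P[mu Dmu] := minPolyOver 1 z.
have muP f : root f^L z = (mu %| f).
  rewrite -(dvdp_map (in_alg L)) -Dmu; apply/idP/idP => [fz|/dvdpP[g ->]].
    by apply: minPoly_dvdp => //; apply/polyOver1P; exists f.
  by rewrite rootM root_minPoly orbT.
have size_mu : size mu = (\dim {:L}).+1.
  rewrite -(size_map_poly (in_alg L)) -Dmu size_minPoly genL.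
  by rewrite dim_Fadjoin dimv1 muln1.
exists z, mu; split=> //; last first.
  by move=> y; apply/Fadjoin1_polyP; rewrite -genL memvf.
split=> [|d d_neq1 dvd_d_mu]; first by rewrite size_mu ltnS adim_gt0.
have := @minPoly_irr _ _ 1 z d^L; rewrite Dmu dvdp_map eqp_map => /(_ _ dvd_d_mu).
case/(_ _)/orP=> //; first by apply/polyOver1P; exists d.
by rewrite -size_poly_eq1 size_map_poly (negPf d_neq1).
Qed.

End PrimitiveElement.

Lemma irreducible_multiplicity (F : fieldType) (mu p : {poly F}) :
    irreducible_poly mu -> p != 0 ->
  exists q h, p = mu ^+ q * h /\ ~~ (mu %| h).
Proof.
case=> mu_gt1 _; have [n] := ubnP (size p).
elim: n p => // n IHn p lt_p_n p_neq0.
have [/dvdpP[g Dp]|mu'p] := boolP (mu %| p); last first.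
  by exists 0%N, p; rewrite mul1r.
have [g_neq0 mu_neq0] : g != 0 /\ mu != 0.
  by apply/andP; rewrite -negb_or -mulf_eq0 -Dp.
have lt_g_n : (size g < n)%N.
  rewrite -ltnS (leq_trans _ lt_p_n) // Dp size_mul // -(subnKC mu_gt1).
  by rewrite addnC !addSn ltnS /= ltnS leq_addl.
have [q [h [Dg mu'h]]] := IHn g lt_g_n g_neq0.
by exists q.+1, h; rewrite Dp Dg exprS; split=> //; ring.
Qed.

Section FieldSubalgebra.

Variables (F : fieldType) (S : falgType F) (m : nat) (tau : {scalar S}).
Hypothesis char0 : [pchar F] =i pred0.
Hypothesis CH : forall x : S, chi_eval m (fun i => tau (x ^+ i)) x = 0.

(** Euler's dual basis: the powers of z are paired with the coefficients of mu(x) / (x - z) divided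
    by mu'(z), here with an extra factor 1 / q. [iota] is not assumed unital, so that corners e S e
    are covered. *)
Lemma tau_field_dual_basis (L : fieldExtType F) (iota : {linear L -> S}) :
    {morph iota : x y / x * y} -> injective iota ->
  exists q : nat, exists a b : 'I_(\dim {:L}) -> L,
  [/\ (0 < q)%N,
      forall i j, tau (iota (a i * b j)) = (i == j)%:R,
      forall y, y = \sum_j tau (iota (y * b j)) *: a j,
      forall y, y = \sum_j tau (iota (y * a j)) *: b j &
      \sum_j a j * b j = q%:R^-1%:A].
Proof.
move=> iotaM iota_inj.
have [z [mu [z_neq0 irr_mu size_mu muP genL]]] := primitive_min_poly L char0.
pose rho : {scalar L} := tau \o iota.
pose f_ (f : {poly F}) := map_poly (in_alg L) f.
pose p i := tau (iota z ^+ i).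
pose chi := tracial_char_poly m p.
pose N := map_poly rho (divdiff z mu).
have iotaX y n : iota (y ^+ n.+1) = iota y ^+ n.+1.
  by elim: n => [|n IHn]; rewrite ?expr1 // exprS iotaM IHn -exprS.
(* The factor [iota 1] matters only for exponent 0, where [iota 1] may be an idempotent other than
   1. *)
have iotaX1 y n : iota (y ^+ n) = iota 1 * iota y ^+ n.
  by case: n => [|n]; rewrite ?expr0 ?mulr1 // -iotaX -iotaM mul1r.
have chi_z : root (f_ chi) z.
  apply/rootP/iota_inj; rewrite linear0 /f_ horner_tracial_char_poly chi_evalE.
  transitivity (iota 1 * chi_eval m p (iota z)); last by rewrite CH mulr0.
  rewrite linear_sum chi_evalE mulr_sumr.
  by apply: eq_bigr => k _; rewrite linearZ /= iotaX1 scalerAr.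
have chi_neq0 : chi != 0 by apply: tracial_char_poly_neq0.
have mu_root : root (f_ mu) z by rewrite muP.
have mu_neq0 : mu != 0 by rewrite -size_poly_eq0 size_mu.
have [q [h [Dchi mu'h]]] := irreducible_multiplicity irr_mu chi_neq0.
have q_gt0 : (0 < q)%N.
  by case: q Dchi => // Dchi; move: chi_z; rewrite muP Dchi mul1r (negPf mu'h).
have size_N : (size N <= \dim {:L})%N.
  by rewrite -[\dim _]/(\dim _).+1.-1 -size_mu size_map_divdiff.
have size_mu' : (size mu^`() <= \dim {:L})%N.
  by rewrite -ltnS -size_mu lt_size_deriv.
(* Both sides have degree below that of [mu], so it suffices that [mu] divides the difference.
   Cancelling mu^(q-1) in the Newton relation for [chi] leaves X h (q mu' - N) = mu (kappa h - X
   h'), and [mu] is coprime to X and h. *)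
have DN : N = q%:R *: mu^`().
  apply/esym/eqP; rewrite -subr_eq0; apply: contraT => nz.
  have: mu %| q%:R *: mu^`() - N; last first.
    move/(dvdp_leq nz); rewrite size_mu leqNgt ltnS.
    rewrite (leq_trans (size_polyD _ _)) // size_polyN geq_max size_N andbT.
    by rewrite (leq_trans (size_scale_leq _ _)).
  have mu'X : coprimep mu 'X.
    rewrite irreducible_poly_coprime // -muP map_polyX.
    by rewrite /root hornerX.
  have cop_h : coprimep mu h by rewrite irreducible_poly_coprime.
  rewrite -(Gauss_dvdpr _ cop_h) -(Gauss_dvdpr _ mu'X).
  case: q q_gt0 Dchi {nz} => // q _ Dchi.
  have := @map_divdiff_newton F L z rho m (P_coef p) (m%:R - rho 1) chi_z.
  rewrite opprB addrC subrK => /(_ (erefl _)) newton.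
  have {newton} : 'X * map_poly rho (divdiff z chi)
      = 'X * chi^`() - (m%:R - rho 1) *: chi.
    apply: newton => k; rewrite -(newton_P_coef p char0).
    apply: eq_bigr => l _; congr (_ * _); rewrite /p /=.
    by rewrite -[(k - l)%N]prednK ?subn_gt0 // iotaX.
  rewrite {1}Dchi exprS -mulrA divdiffM // map_scalarM -/N.
  rewrite Dchi derivM deriv_exp /=.
  rewrite exprS -mulr_natr -[_ *: (_ * h)]mul_polyC scaler_nat -mulr_natr.
  set kappa := _%:P => eqn.
  apply/dvdpP; exists (kappa * h - 'X * h^`()).
  apply: (mulfI (expf_neq0 q mu_neq0)).
  transitivity (mu ^+ q * 'X * h * (mu^`() * q.+1%:R) - 'X * (mu ^+ q * h * N)).
    by ring.
  by rewrite eqn; ring.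
pose theta := (f_ mu^`()).[z].
have theta_neq0 : theta != 0.
  rewrite -/(root _ _) muP; apply: contraL size_mu' => dvd_mu_mu'.
  have mu'_neq0 : mu^`() != 0.
    apply/eqP => /polyP/(_ (\dim {:L}).-1)/eqP.
    have dimL_gt0 := adim_gt0 {:L}%AS.
    rewrite coef_deriv prednK // coef0 -mulr_natl mulf_eq0.
    move/pcharf0P: char0 => ->; rewrite -[mu`_ _]/(mu`_(\dim {:L}).+1.-1) -size_mu.
    by rewrite -[mu`_ _]/(lead_coef mu) lead_coef_eq0 (negPf mu_neq0) orbF eqn0Ngt dimL_gt0.
  by rewrite -ltnNge -size_mu dvdp_leq.
have q_neq0 : q%:R != 0 :> F by move/pcharf0P: char0 => ->; rewrite -lt0n.
pose a (i : 'I_(\dim {:L})) := z ^+ i.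
pose b (j : 'I_(\dim {:L})) := q%:R^-1 *: (theta^-1 * (divdiff z mu)`_j).
have expand y : exists c : 'I_(\dim {:L}) -> F, y = \sum_i c i *: a i.
  have [f ->] := genL y; exists (fun i => (f %% mu)`_i).
  rewrite [in LHS](divp_eq f mu) rmorphD rmorphM !hornerE (rootP mu_root).
  rewrite mulr0 add0r (@horner_coef_wide _ (\dim {:L})).
    by apply: eq_bigr => i _; rewrite coef_map mulr_algl.
  by rewrite size_map_poly -ltnS -size_mu ltn_modp.
have ab i j : tau (iota (a i * b j)) = (i == j)%:R.
  (* Write z^i / mu'(z) = f(z). Modulo [mu], the image under [rho] of f(z) [divdiff z mu] is f N = q
     f mu', which takes the value q z^i at z. By degrees it equals q X^i, and its j-th coefficient
     is the pairing wanted, up to the factor q. *)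
  have [f Df] := genL (a i * theta^-1).
  rewrite -scalerAr linearZ linearZ /= -[tau _]/(rho _) mulrA Df.
  have [g Dg] := map_scalarC_divdiff rho f mu_root.
  have : map_poly rho ((f_ f).[z] *: divdiff z mu) = q%:R *: 'X^i.
    apply/eqP; rewrite -subr_eq0; apply: contraT => nz.
    have: mu %| map_poly rho ((f_ f).[z] *: divdiff z mu) - q%:R *: 'X^i.
      rewrite /f_ Dg -/N DN addrAC dvdp_sub // ?dvdp_mull // -scalerAr -scalerBr.
      rewrite dvdpZr // -muP /root rmorphB rmorphM !hornerE /= map_polyXn hornerXn.
      by rewrite -Df -/(f_ _) -/theta mulfVK // subrr.
    move/(dvdp_leq nz); rewrite size_mu leqNgt ltnS.
    rewrite (leq_trans (size_polyD _ _)) // size_polyN geq_max.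
    rewrite (leq_trans (size_scale_leq _ _)) ?size_polyXn // andbT.
    rewrite (leq_trans (size_poly _ _)) // (leq_trans (size_scale_leq _ _)) //.
    by rewrite size_divdiff size_mu.
  move/polyP/(_ j); rewrite coef_map coefZ coefZ coefXn /= => ->.
  by rewrite mulKf // eq_sym.
exists q, a, b; split=> // [y|y|].
- have [c ->] := expand y; apply: eq_bigr => j _; congr (_ *: _).
  rewrite mulr_suml !linear_sum (bigD1 j) //= -scalerAl !linearZ /= ab eqxx mulr1.
  by rewrite big1 ?addr0 // => i /negPf i_j; rewrite -scalerAl !linearZ /= ab i_j mulr0.
- apply/eqP; rewrite -subr_eq0; set w := y - _; apply: contraT => w_neq0.
  have rho_aw i : rho (a i * w) = 0.
    rewrite mulrBr linearB mulr_sumr linear_sum (bigD1 i) //= big1 => [|j /negPf j_i].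
      by rewrite addr0 -scalerAr !linearZ /= ab eqxx mulr1 mulrC subrr.
    by rewrite -scalerAr !linearZ /= ab eq_sym j_i mulr0.
  (* If w were nonzero, every element of L would be a multiple of w, so [rho] would vanish
     identically, whereas it is 1 on [a i0 * b i0]. *)
  pose i0 := Ordinal (adim_gt0 {:L}%AS).
  have /eqP[] : rho (a i0 * b i0) != 0 by rewrite /= ab eqxx oner_neq0.
  have [c Dc] := expand (a i0 * b i0 / w).
  rewrite -[a i0 * _](mulfVK w_neq0) Dc.
  rewrite mulr_suml linear_sum big1 // => i _.
  by rewrite -scalerAl linearZ /= -[tau _]/(rho _) rho_aw mulr0.
under eq_bigr => j _ do rewrite -scalerAr mulrCA.
rewrite -scaler_sumr -mulr_sumr.
have -> : \sum_j a j * (divdiff z mu)`_j = (divdiff z mu).[z].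
  rewrite (@horner_coef_wide _ (\dim {:L})).
    by apply: eq_bigr => j _; rewrite mulrC.
  by rewrite size_divdiff size_mu.
by rewrite horner_divdiff // mulVf.
Qed.

End FieldSubalgebra.

(** * Subspaces of S that are fields *)

Section Field.

Variables (F : fieldType) (S : falgType F).
(** A subspace closed under products is an algebra with its own unit [algid], which may differ from
    1 in S; L is this algebra and [iota] its inclusion. *)
Lemma commutative_division_aspace_fieldExt (K : {vspace S}) (e : S) :
    e != 0 -> e \in K -> {in K, forall x, e * x = x} ->
    {in K &, forall x y, x * y \in K} -> {in K &, forall x y, x * y = y * x} ->
    {in K, forall x, x != 0 -> exists2 y, y \in K & x * y = e} ->
  exists (L : fieldExtType F) (iota : {linear L -> S}),
    [/\ {morph iota : x y / x * y}, injective iota, iota 1 = e,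
        forall x, x \in K <-> exists y, x = iota y & \dim {:L} = \dim K].
Proof.
move=> e0 eK eK1 KM KC KV.
have asK : is_aspace K.
  apply/andP; split; last by apply/prodvP.
  by apply/has_algidP; exists e; split=> // x xK; rewrite ?eK1 // KC // eK1.
pose A := ASpace asK.
pose T := subvs_of A.
have algE : algid A = e.
  by rewrite -[LHS](eK1 _ (memv_algid A)) (algidr (A:=A)).
have mulC : commutative (@GRing.mul T).
  by move=> x y; apply: val_inj; rewrite /= KC ?subvsP.
have fldP : GRing.field_axiom T.
  move=> x x0; apply/unitrP.
  have [||y yK xy] := KV (vsval x); rewrite ?subvsP //.
  have xy1 : x * vsproj A y = 1 by apply: val_inj; rewrite /= vsprojK // algE.
  by exists (vsproj A y); rewrite mulC xy1.
pose cM := GRing.PzRing_hasCommutativeMul.Build T mulC.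
pose C : comUnitRingType := HB.pack T cM.
pose fM := GRing.ComUnitRing_isField.Build C fldP.
pose L : fieldExtType F := HB.pack T C fM.
pose iota : {linear L -> S} := (vsval : {linear T -> S}).
exists L, iota; split.
- by [].
- exact: val_inj.
- exact: algE.
- move=> x; split=> [xK|[y ->]]; last exact: subvsP.
  by exists (vsproj A x); rewrite /= vsprojK.
- by rewrite dimvf.
Qed.

End Field.

(** * Prime algebras *)

Definition prime_algebra (F : fieldType) (S : falgType F) : Prop :=
  forall a b : S, (forall x, a * x * b = 0) -> a = 0 \/ b = 0.

Section PrimeAlgebra.

Variables (F : fieldType) (S : falgType F).
Hypothesis Sprime : prime_algebra S.

(** Descent on the dimension of the right ideal xS. Minimality of the ideal generated by [x * s] is
    phrased elementwise: each nonzero multiple of [x * s] generates it again. *)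
Lemma minimal_right_ideal (x : S) : x != 0 ->
  exists2 s, x * s != 0
    & forall s', x * s * s' != 0 -> exists t, x * s = x * s * s' * t.
Proof.
have [n] := ubnP (\dim (limg (amull x))); elim: n x => // n IHn x lt_x_n x_neq0.
have limgM s : (limg (amull (x * s)%R) <= limg (amull x))%VS.
  apply/subvP=> _ /memv_imgP[v _ ->]; rewrite lfunE /= -mulrA.
  by apply/memv_imgP; exists (s * v); rewrite ?memvf ?lfunE.
have [[s [xs_neq0 lt_xs_x]]|minx] := classic (exists s,
    x * s != 0 /\ (\dim (limg (amull (x * s)%R)) < \dim (limg (amull x)))%N).
  have [|s' xss' mins'] := IHn (x * s) _ xs_neq0.
    exact: leq_trans lt_xs_x _.
  by exists (s * s'); rewrite mulrA.
exists 1; rewrite mulr1 // => s xs_neq0.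
have /eqP eq_limg : limg (amull (x * s)%R) == limg (amull x).
  rewrite eqEdim limgM leqNgt; apply/negP => lt_xs_x.
  by apply: minx; exists s.
have: x \in limg (amull (x * s)%R).
  by rewrite eq_limg; apply/memv_imgP; exists 1; rewrite ?memvf ?lfunE /= ?mulr1.
by case/memv_imgP => t _; rewrite lfunE; exists t.
Qed.

(** Brauer's lemma: a minimal right ideal uS inside xS has nonzero square by primeness, hence is
    generated by an idempotent e, and e S e is a division algebra. *)
Lemma division_idempotent (x : S) : x != 0 ->
  exists e, [/\ e != 0, e * e = e, exists s, e = x * s
    & forall w, w != 0 -> e * w * e = w -> exists2 v, e * v * e = v & w * v = e].
Proof.
move=> x_neq0; have [s] := minimal_right_ideal x_neq0.
move Du: (x * s) => u u_neq0 minu.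
have [y uyu_neq0] : exists y, u * y * u != 0.
  apply: NNPP => no_y; have [y||] := @Sprime u u; [|exact/eqP..].
  by apply/eqP; apply: contraT => uyu_neq0; case: no_y; exists y.
have [t Dt] : exists t, u = u * (y * u) * t by apply: minu; rewrite mulrA.
pose e := u * t * y.
have uye : u * y * e = u * y by rewrite /e !mulrA -[u * y * u]mulrA -Dt.
have e_neq0 : e != 0.
  by apply: contraNneq uyu_neq0 => e0; rewrite -uye e0 mulr0 mul0r.
have ee : e * e = e.
  (* Were e^2 - e nonzero, minimality would give u = (e^2 - e) r; but u y kills e^2 - e on the left
     because u y e = u y, so u y u = 0. *)
  apply/eqP; rewrite -subr_eq0; apply: contraNT uyu_neq0.
  have De : e * e - e = u * (t * y * e - t * y) by rewrite mulrBr /e !mulrA.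
  rewrite De => /minu[r]; rewrite -De => Du'.
  by rewrite {2}Du' mulrA mulrBr mulrA !uye subrr mul0r.
have De : e = u * (t * y) by rewrite mulrA.
clearbody e; exists e; split=> //; first by exists (s * t * y); rewrite De !mulrA Du.
move=> w w_neq0 Dw; have we : w * e = w by rewrite -Dw -mulrA ee.
have Dw' : w = u * (t * y * w) by rewrite -{1}Dw -[e * w * e]mulrA we De !mulrA.
have [r Dr] : exists r, u = w * r by rewrite Dw'; apply: minu; rewrite -Dw'.
exists (e * (r * (t * y)) * e); first by rewrite !mulrA ee -[LHS]mulrA ee.
by rewrite 2!mulrA we mulrA -Dr -De ee.
Qed.

End PrimeAlgebra.

(** * Nondegeneracy of a Cayley-Hamilton trace *)

Section CayleyHamiltonTrace.

Variables (F : fieldType) (S : falgType F) (m : nat) (tau : {scalar S}).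
Hypothesis char0 : [pchar F] =i pred0.
Hypothesis CH : forall x : S, chi_eval m (fun i => tau (x ^+ i)) x = 0.

(** If tau(e) = 0, all power sums of e of positive index vanish, so its characteristic polynomial is
    x^m and Cayley-Hamilton forces e^m = 0. *)
Lemma tau_idempotent_neq0 (e : S) : e != 0 -> e * e = e -> tau e != 0.
Proof.
move=> e_neq0 ee; apply: contraNneq e_neq0 => te0.
have eX k : (0 < k)%N -> e ^+ k = e.
  by elim: k => // -[|k] IHk _; rewrite ?expr1 // exprS IHk.
have P0 k : (0 < k)%N -> P_coef (fun i => tau (e ^+ i)) k = 0.
  move=> k_gt0; have := newton_P_coef (fun i => tau (e ^+ i)) char0 k.
  rewrite big1 => [/eqP|l _]; last by rewrite eX ?subn_gt0 // te0 mulr0.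
  rewrite eq_sym oppr_eq0 mulf_eq0; move/pcharf0P: char0 => ->.
  by rewrite eqn0Ngt k_gt0 => /eqP.
have := CH e; rewrite chi_evalE big_ord_recl big1 => [|k _].
  rewrite P_coef0 scale1r addr0 subn0; case: m => [|k]; last by rewrite eX // => ->.
  by move/eqP; rewrite expr0 oner_eq0.
by rewrite P0 ?scale0r.
Qed.

Hypothesis tauC : forall x y : S, tau (x * y) = tau (y * x).
Hypothesis Sprime : prime_algebra S.

(** A nonzero right ideal xS contains a nonzero idempotent, where [tau] does not vanish. *)
Lemma tau_nondegenerate (x : S) : (forall y, tau (x * y) = 0) -> x = 0.
Proof.
move=> tau_x0; apply/eqP; apply: contraT.
case/(division_idempotent Sprime) => e [e_neq0 ee [s De] _].
by have := tau_idempotent_neq0 e_neq0 ee; rewrite De tau_x0 eqxx.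
Qed.

End CayleyHamiltonTrace.

(** * Maximal commutative subspaces and divisibility of dimensions *)

Section MaximalCommutative.

Variables (F : fieldType) (S : falgType F).

(** Induction on codimension in D, adjoining one commuting vector at a time. Closure of K under
    products is not imposed: it follows from maximality when D is a corner. *)
Lemma maximal_commutative_subspace (D : {vspace S}) : exists K : {vspace S},
  [/\ (K <= D)%VS, {in K &, forall x y, x * y = y * x} &
      {in D, forall x, {in K, forall y, x * y = y * x} -> x \in K}].
Proof.
suff /(_ (\dim D) 0%VS) [|||K [sKD KC _ maxK]] : forall n (V : {vspace S}),
    (V <= D)%VS -> {in V &, forall x y, x * y = y * x} -> (\dim D - \dim V <= n)%N ->
  exists K : {vspace S}, [/\ (K <= D)%VS, {in K &, forall x y, x * y = y * x},
    (V <= K)%VS &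
    {in D, forall x, {in K, forall y, x * y = y * x} -> x \in K}].
- exact: sub0v.
- by move=> x y /[!memv0]/eqP-> /eqP->.
- exact: leq_subr.
- by exists K.
elim=> [|n IHn] V sVD VC le_n.
  exists V; split=> // x xD _; suff -> : V = D by [].
  by apply/eqP; rewrite eqEdim sVD -subn_eq0 -leqn0.
have [[x [xD xV xC]]|maxV] := classic (exists x,
    [/\ x \in D, x \notin V & {in V, forall y, x * y = y * x}]); last first.
  exists V; split=> // x xD xC; apply: contraT => xV; case: maxV.
  by exists x.
have x_neq0 : x != 0 by apply: contraNneq xV => ->; rewrite mem0v.
have [||| K [sKD KC sVK maxK]] := IHn (V + <[x]>)%VS.
- by rewrite subv_add sVD -memvE.
- move=> _ _ /memv_addP[u uV [_ /vlineP[a ->] ->]] /memv_addP[v vV [_ /vlineP[b ->] ->]].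
  rewrite !(mulrDl, mulrDr) -!(scalerAl, scalerAr) VC // (xC v) // (xC u) //.
  by rewrite !scalerA [a * b]mulrC addrACA [X in _ + X]addrC.
- have ltVx : (\dim V < \dim (V + <[x]>))%N.
    rewrite ltn_neqAle dimvS ?addvSl // andbT.
    apply: contra xV => /eqP eq_dim.
    have /eqP -> : V == (V + <[x]>)%VS by rewrite eqEdim addvSl eq_dim /=.
    by rewrite memvE addvSr.
  rewrite -ltnS (leq_trans _ le_n) // ltn_sub2l //.
  by rewrite (leq_trans ltVx) // dimvS // subv_add sVD -memvE.
by exists K; split=> //; apply: subv_trans sVK; rewrite addvSl.
Qed.

(** S is a left vector space over the division algebra K: a K-stable subspace is enlarged by direct
    summands Kx, each of dimension that of K. *)
Lemma dim_division_module (K : {vspace S}) :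
    1 \in K -> {in K &, forall x y, x * y \in K} ->
    {in K, forall x, x != 0 -> exists2 y, y \in K & y * x = 1} ->
  (\dim K %| \dim {:S})%N.
Proof.
move=> K1 KM KV.
suff /(_ (\dim {:S}) 0%VS) [||| W [_ dvd_W ->]] : forall n (V : {vspace S}),
    {in K & V, forall x y, x * y \in V} -> (\dim K %| \dim V)%N ->
    (\dim {:S} - \dim V <= n)%N ->
  exists W : {vspace S}, [/\ {in K & W, forall x y, x * y \in W}, (\dim K %| \dim W)%N
    & {:S}%VS = W] => //.
- by move=> x y _ /[!memv0]/eqP->; rewrite mulr0.
- by rewrite dimv0.
- exact: leq_subr.
elim=> [|n IHn] V KV_V dvd_V le_n.
  exists V; split=> //; apply/esym/eqP.
  by rewrite eqEdim subvf -subn_eq0 -leqn0.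
have [defV|/subvPn[x _ xV]] := boolP ({:S} <= V)%VS.
  by exists V; split=> //; apply/eqP; rewrite eqEsubv defV subvf.
have x_neq0 : x != 0 by apply: contraNneq xV => ->; rewrite mem0v.
pose Kx := (amulr x @: K)%VS.
have KxP y : reflect (exists2 k, k \in K & y = k * x) (y \in Kx).
  by apply: (iffP memv_imgP) => -[k kK ->]; exists k; rewrite ?lfunE.
have dimKx : \dim Kx = \dim K.
  apply: limg_dim_eq; apply/eqP; rewrite -subv0; apply/subvP=> k.
  rewrite memv_cap memv_ker lfunE memv0 /= => /andP[kK /eqP kx0].
  apply: contraNT x_neq0 => /(KV k kK)[k' _ kk'].
  by rewrite -[x]mul1r -kk' -mulrA kx0 mulr0.
have dxVx : (V :&: Kx = 0)%VS.
  apply/eqP; rewrite -subv0; apply/subvP=> y /memv_capP[yV /KxP[k kK Dy]].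
  rewrite memv0 Dy; have [->|k_neq0] := eqVneq k 0; first by rewrite mul0r.
  have [k' k'K kk'] := KV k kK k_neq0.
  by case/negP: xV; rewrite -[x]mul1r -kk' -mulrA -Dy KV_V.
have dimVx : \dim (V + Kx) = (\dim V + \dim K)%N by rewrite dimv_disjoint_sum // dimKx.
have K_gt0 : (0 < \dim K)%N.
  by rewrite lt0n dimv_eq0; apply: contraTneq K1 => ->; rewrite memv0 oner_neq0.
apply: (IHn (V + Kx)%VS).
- move=> a y aK /memv_addP[v vV [_ /KxP[k kK ->] ->]].
  rewrite mulrDr mulrA memv_add ?KV_V //; apply/KxP.
  by exists (a * k); rewrite ?KM.
- by rewrite dimVx dvdn_addr.
rewrite -ltnS (leq_trans _ le_n) // ltn_sub2l // ?dimVx ?[X in (X < _)%N]dimVx.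
  by rewrite (leq_trans _ (dimvS (subvf (V + Kx)))) // dimVx -addn1 leq_add2l.
by rewrite -addn1 leq_add2l.
Qed.

End MaximalCommutative.

(** * Dual bases and Casimir elements *)

Section DualBases.

Variables (F : fieldType) (S : falgType F) (tau : {scalar S}).
Hypothesis tauC : forall x y : S, tau (x * y) = tau (y * x).
Hypothesis tau_nondeg : forall x : S, (forall y, tau (x * y) = 0) -> x = 0.

Lemma dual_basis_exists : exists t : 'I_(\dim {:S}) -> S,
  (forall x, x = \sum_(i < \dim {:S}) tau (x * t i) *: (vbasis {:S})`_i) /\
  (forall x, x = \sum_(i < \dim {:S}) tau (x * (vbasis {:S})`_i) *: t i).
Proof.
set s := vbasis {:S}.
have expand x : x = \sum_(i < \dim {:S}) coord s i x *: s`_i by apply/coord_vbasis/memvf.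
have s_free : free s := basis_free (vbasisP {:S}).
(* The Gram operator of the form tau(xy): it is injective by nondegeneracy, and the preimages of the
   basis vectors form the dual basis. *)
pose f (x : S) := \sum_(i < \dim {:S}) tau (x * s`_i) *: s`_i.
have f_lin : linear f.
  move=> a x y; rewrite scaler_sumr -big_split; apply: eq_bigr => i _ /=.
  by rewrite mulrDl -scalerAl linearP scalerDl scalerA.
pose g : {linear S -> S} :=
  HB.pack f (GRing.isLinear.Build F S S _ _ f_lin).
have fE x : linfun g x = \sum_(i < \dim {:S}) tau (x * s`_i) *: s`_i by rewrite lfunE.
have orth x : (forall i : 'I_(\dim {:S}), tau (x * s`_i) = 0) -> x = 0.
  move=> x0; apply: tau_nondeg => y; rewrite (expand y) mulr_sumr linear_sum.
  by apply: big1 => i _; rewrite -scalerAr linearZ /= x0 mulr0.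
have ker_f : lker (linfun g) == 0%VS.
  apply/lker0P => x y; rewrite !fE => eq_xy; apply/eqP; rewrite -subr_eq0.
  apply/eqP/orth => i; apply/eqP; rewrite mulrBl linearB subr_eq0.
  by have := congr1 (coord s i) eq_xy; rewrite !coord_sum_free // => ->.
pose t (j : 'I_(\dim {:S})) := (linfun g)^-1%VF s`_j.
have ts j (i : 'I_(\dim {:S})) : tau (t j * s`_i) = (i == j)%:R.
  have := congr1 (coord s i) (lker0_lfunVK ker_f s`_j).
  by rewrite fE coord_sum_free // coord_free // eq_sym.
exists t; split=> x.
  rewrite [LHS]expand; apply: eq_bigr => i _; congr (_ *: _).
  rewrite {2}(expand x) mulr_suml linear_sum (bigD1 i) //= big1 => [|k /negPf k_i].
    by rewrite addr0 -scalerAl linearZ /= tauC ts eqxx mulr1.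
  by rewrite -scalerAl linearZ /= tauC ts k_i mulr0.
apply/eqP; rewrite -subr_eq0; apply/eqP/orth => i.
rewrite mulrBl linearB mulr_suml linear_sum (bigD1 i) //= big1 => [|k /negPf k_i].
  by rewrite addr0 -scalerAl linearZ /= ts eqxx mulr1 subrr.
by rewrite -scalerAl linearZ /= ts eq_sym k_i mulr0.
Qed.

(** The i-th coordinate functional is pairing with [t i], so the diagonal entries of left
    multiplication by a are tau(a s_i t_i). *)
Lemma trace_amull_dual (t : 'I_(\dim {:S}) -> S) (a : S) :
    (forall x, x = \sum_(i < \dim {:S}) tau (x * t i) *: (vbasis {:S})`_i) ->
  \tr (passmx.mxof (vbasis {:S}) (vbasis {:S}) (amull a))
    = tau (a * \sum_(i < \dim {:S}) (vbasis {:S})`_i * t i).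
Proof.
move=> dual_t; rewrite mulr_sumr linear_sum; apply: eq_bigr => i _.
have s_free := basis_free (vbasisP {:S}).
rewrite /passmx.mxof mxE /= passmx.vecof_delta lfunE /= mxE.
by rewrite [X in coord _ _ X]dual_t coord_sum_free // mulrA.
Qed.

End DualBases.

Section Casimir.

Variables (F : fieldType) (S : falgType F) (tau : {scalar S}).
Hypothesis tauC : forall x y : S, tau (x * y) = tau (y * x).

(** By cyclicity tau(k s_j t_i) = tau(t_i k s_j), so the two expansions share one matrix up to
    transposition. Asking for them only at the given k covers dual bases of S and of a subfield
    alike. *)
Lemma casimir_commutes (n : nat) (s t : 'I_n -> S) (k y : S) :
    (forall i, k * s i = \sum_j tau (k * s i * t j) *: s j) ->
    (forall i, t i * k = \sum_j tau (t i * k * s j) *: t j) ->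
  k * (\sum_i s i * y * t i) = (\sum_i s i * y * t i) * k.
Proof.
move=> ks tk; rewrite mulr_sumr mulr_suml.
under eq_bigr => i _ do rewrite !mulrA ks mulr_suml mulr_suml.
rewrite exchange_big; apply: eq_bigr => j _ /=.
rewrite -mulrA tk mulr_sumr; apply: eq_bigr => i _.
by rewrite -!scalerAl -scalerAr tauC mulrA.
Qed.

End Casimir.

(** * The Casimir element as a scalar, and the reduced trace *)

Section MainIdentity.

Variables (F : fieldType) (S : falgType F) (m : nat) (tau : {scalar S}).
Hypothesis char0 : [pchar F] =i pred0.
Hypothesis CH : forall x : S, chi_eval m (fun i => tau (x ^+ i)) x = 0.
Hypothesis tau1 : tau 1 = m%:R.

Lemma tau_division_subspace_dual_basis (K : {vspace S}) (e : S) :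
    e != 0 -> e \in K -> {in K, forall x, e * x = x} ->
    {in K &, forall x y, x * y \in K} -> {in K &, forall x y, x * y = y * x} ->
    {in K, forall x, x != 0 -> exists2 y, y \in K & x * y = e} ->
  exists q : nat, exists a b : 'I_(\dim K) -> S,
  [/\ [/\ (0 < q)%N, forall i, a i \in K & forall i, b i \in K],
      forall i j, tau (a i * b j) = (i == j)%:R,
      forall y, y \in K -> y = \sum_j tau (y * b j) *: a j,
      forall y, y \in K -> y = \sum_j tau (y * a j) *: b j &
      \sum_j a j * b j = q%:R^-1 *: e].
Proof.
move=> e_neq0 eK eK1 KM KC KV.
have [L [iota [iotaM iota_inj iota1 KP dimL]]] :=
  commutative_division_aspace_fieldExt e_neq0 eK eK1 KM KC KV.
have [q [a [b [q_gt0 ab expa expb sum_ab]]]] :=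
  tau_field_dual_basis char0 CH iotaM iota_inj.
rewrite -dimL; exists q, (iota \o a), (iota \o b).
split=> [|i j|_ /KP[y ->]|_ /KP[y ->]|] /=.
- by split=> // i; apply/KP; eexists.
- by rewrite -iotaM ab.
- rewrite [in LHS](expa y) linear_sum; apply: eq_bigr => j _.
  by rewrite linearZ iotaM.
- rewrite [in LHS](expb y) linear_sum; apply: eq_bigr => j _.
  by rewrite linearZ iotaM.
rewrite -iota1 -linearZ -sum_ab linear_sum.
by apply: eq_bigr => j _; rewrite iotaM.
Qed.

Hypothesis tauC : forall x y : S, tau (x * y) = tau (y * x).
Hypothesis Sprime : prime_algebra S.

Local Notation Z := ('Z({:S}))%VS.

Lemma mem_centerP x : reflect (forall y, x * y = y * x) (x \in Z).
Proof.
rewrite memv_cap memvf; apply: (iffP centvP) => [xC y|xC y _]; last by [].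
by rewrite xC ?memvf.
Qed.

(** Multiplication by a nonzero central x is injective by primeness, hence bijective in finite
    dimension; the inverse is central because x is. *)
Lemma center_division (x : S) :
  x \in Z -> x != 0 -> exists2 y, y \in Z & x * y = 1.
Proof.
move=> /mem_centerP xC x_neq0.
have x_reg y : x * y = 0 -> y = 0.
  move=> xy0; have [||] // := @Sprime x y.
    by move=> s; rewrite xC -mulrA xy0 mulr0.
  by move/eqP; rewrite (negPf x_neq0).
have ker_x : lker (amull x) == 0%VS.
  by rewrite -subv0; apply/subvP=> y; rewrite memv_ker lfunE memv0 => /eqP/x_reg /= ->.
pose y := (amull x)^-1%VF 1.
have xy1 : x * y = 1 by have := lker0_lfunVK ker_x 1; rewrite lfunE.
exists y => //; apply/mem_centerP => s; apply/eqP; rewrite -subr_eq0; apply/eqP/x_reg.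
by rewrite mulrBr mulrA xy1 mul1r mulrA xC -mulrA xy1 mulr1 subrr.
Qed.

Lemma maximal_subfield : exists (e : S) (K : {vspace S}),
  [/\ [/\ e != 0, e * e = e & e \in K],
      {in K, forall x, e * x = x} /\ {in K, forall x, x * e = x},
      {in K &, forall x y, x * y = y * x},
      {in K, forall x, x != 0 -> exists2 y, y \in K & x * y = e} &
      forall x, e * x * e = x -> {in K, forall y, x * y = y * x} -> x \in K].
Proof.
have [e [e_neq0 ee _ eSe_div]] := division_idempotent Sprime (oner_neq0 S).
pose D := limg (amulr e \o amull e)%VF.
have DP x : reflect (e * x * e = x) (x \in D).
  apply: (iffP memv_imgP) => [[y _ ->]|Dx].
    by rewrite comp_lfunE !lfunE /= !mulrA ee -mulrA ee.
  by exists x; rewrite ?memvf // comp_lfunE !lfunE.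
have [K [/subvP sKD KC maxK]] := maximal_commutative_subspace D.
have maxK' x : e * x * e = x -> {in K, forall y, x * y = y * x} -> x \in K.
  by move=> /DP; apply: maxK.
have eK x : x \in K -> e * x = x by move/sKD/DP=> Dx; rewrite -{1}Dx !mulrA ee.
have Ke x : x \in K -> x * e = x.
  by move/sKD/DP=> Dx; rewrite -{1}Dx -mulrA ee.
exists e, K; split=> //.
- by split=> //; apply: maxK' => [|y yK]; rewrite ?ee ?eK ?Ke.
move=> x xK x_neq0; have [|v Dv xv] := eSe_div x x_neq0; first exact/DP/sKD.
have v_neq0 : v != 0 by apply: contraNneq e_neq0 => v0; rewrite -xv v0 mulr0.
have ev : e * v = v by rewrite -Dv !mulrA ee.
have ve : v * e = v by rewrite -Dv -mulrA ee.
have vx : v * x = e.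
  (* The right inverse v has a right inverse v' of its own, and x = x v v' = v', so v inverts x on
     both sides. *)
  have [v' Dv' vv'] := eSe_div v v_neq0 Dv.
  suff -> : x = v' by [].
  by rewrite -(Ke x xK) -vv' mulrA xv -Dv' !mulrA ee.
exists v => //; apply: maxK' => // y yK.
by rewrite -[in LHS](Ke y yK) -xv !mulrA -[v * y * x]mulrA (KC y x) // !mulrA vx eK.
Qed.

Lemma natr_pchar0_inj : injective (fun n : nat => n%:R : F).
Proof.
move=> n k; wlog le_nk : n k / (n <= k)%N => [IH eq_nk|eq_nk].
  by case/orP: (leq_total n k) => /IH; [apply|move=> IHk; apply/esym/IHk].
apply/eqP; rewrite eqn_leq le_nk -subn_eq0.
by move/pcharf0P: char0 => <-; rewrite natrB // eq_nk subrr eqxx.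
Qed.

Lemma casimir_scalar :
  exists (p q : nat) (t : 'I_(\dim {:S}) -> S),
  [/\ (0 < p)%N, (0 < q)%N, m = (p * \dim Z)%N,
      forall x, x = \sum_(i < \dim {:S}) tau (x * t i) *: (vbasis {:S})`_i &
      \sum_(i < \dim {:S}) (vbasis {:S})`_i * t i = (p%:R / q%:R ^+ 2)%:A].
Proof.
have [t [exps expt]] := dual_basis_exists tauC
  (tau_nondegenerate char0 CH Sprime).
pose s (i : 'I_(\dim {:S})) := (vbasis {:S})`_i.
pose c := \sum_i s i * t i.
(* The Casimir lemma with the two dual bases exchanged; it makes the averages [C y] central. *)
have sumC (y k : S) : k * (\sum_i t i * y * s i) = (\sum_i t i * y * s i) * k.
  by apply: (casimir_commutes tauC) => i; [apply: expt|apply: exps].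
have cC k : k * c = c * k.
  have := casimir_commutes (s := s) (t := t) tauC (k := k) 1.
  under eq_bigr => i _ do rewrite mulr1.
  by apply=> i; [apply: exps|apply: expt].
have oneZ : 1 \in Z by apply/mem_centerP => y; rewrite mul1r mulr1.
have [p [al [be [[p_gt0 alZ beZ] albe _ expbe sum_albe]]]] :
    exists p : nat, exists al be : 'I_(\dim Z) -> S,
  [/\ [/\ (0 < p)%N, forall i, al i \in Z & forall i, be i \in Z],
      forall i j, tau (al i * be j) = (i == j)%:R,
      forall y, y \in Z -> y = \sum_j tau (y * be j) *: al j,
      forall y, y \in Z -> y = \sum_j tau (y * al j) *: be j &
      \sum_j al j * be j = p%:R^-1 *: 1].
  apply: tau_division_subspace_dual_basis; rewrite ?oner_neq0 //.
  - by move=> x _; rewrite mul1r.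
  - move=> x y /mem_centerP xC /mem_centerP yC; apply/mem_centerP => k.
    by rewrite -mulrA yC mulrA xC mulrA.
  - by move=> x y /mem_centerP xC _.
  - exact: center_division.
have [e [K [[e_neq0 ee eK] [eK1 Ke1] KC KV maxK]]] := maximal_subfield.
have KM : {in K &, forall x y, x * y \in K}.
  move=> x y xK yK; apply: maxK => [|k kK].
    by rewrite -!mulrA (Ke1 y) // mulrA eK1.
  by rewrite -mulrA (KC y k) // mulrA (KC x k) // mulrA.
have [q [a [b [[q_gt0 aK bK] _ expa expb sum_ab]]]] :=
  tau_division_subspace_dual_basis e_neq0 eK eK1 KM KC KV.
have p_neq0 : p%:R != 0 :> F by move/pcharf0P: char0 => ->; rewrite -lt0n.
have q_neq0 : q%:R != 0 :> F by move/pcharf0P: char0 => ->; rewrite -lt0n.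
have ZeK z : z \in Z -> z * e \in K.
  move/mem_centerP => zC; apply: maxK => [|k kK].
    by rewrite [e * (z * e)]mulrA -(zC e) -!mulrA !ee.
  by rewrite -mulrA eK1 // [RHS]mulrA -(zC k) -mulrA Ke1.
pose P y := \sum_j a j * y * b j.
have PC (y k : S) : k \in K -> k * P y = P y * k.
  move=> kK; apply: (casimir_commutes tauC) => i; [apply: expa|apply: expb].
    by rewrite KM.
  by rewrite KM.
have PK y : P y \in K.
  apply: maxK => [|k kK]; last by rewrite PC.
  rewrite mulr_sumr mulr_suml; apply: eq_bigr => j _.
  by rewrite !mulrA eK1 // -mulrA Ke1.
pose C y := \sum_i t i * y * s i.
have CZ y : C y \in Z by apply/mem_centerP => k; rewrite sumC.
have tauCZ y x : x \in Z -> tau (C y * x) = tau (y * c * x).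
  move=> /mem_centerP xC; rewrite mulr_suml mulr_sumr mulr_suml !linear_sum.
  apply: eq_bigr => i _; rewrite -!mulrA tauC -!mulrA; congr (tau (_ * (_ * _))).
  by rewrite xC.
(* Both sides evaluate [\sum_(i, j) tau (z * t i * a j * s i * b j)]. *)
have double_sum z : z \in Z ->
    q%:R^-1 ^+ 2 * tau (z * e) = p%:R^-1 * tau (z * c * e).
  move=> zZ; have /mem_centerP zC := zZ.
  transitivity (\sum_j tau (z * C (a j) * b j)).
    have -> : \sum_j tau (z * C (a j) * b j) = \sum_i tau (z * t i * P (s i)).
      under eq_bigr => j _ do rewrite mulr_sumr mulr_suml linear_sum.
      rewrite exchange_big; apply: eq_bigr => i _.
      by rewrite mulr_sumr linear_sum; apply: eq_bigr => j _; rewrite !mulrA.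
    (* Expanding P(s_i) in K and resumming over i by duality in S turns the sum into that of
       tau(P(b_l z) a_l). As K is commutative, this splits off two factors equal to e / q. *)
    under eq_bigr => i _ do rewrite [P (s i)](expb _ (PK _)) mulr_sumr linear_sum.
    rewrite exchange_big /=.
    transitivity (\sum_l tau (P (b l * z) * a l)).
      transitivity (tau ((\sum_j a j * b j) * z * \sum_l b l * a l)).
        have -> : \sum_l b l * a l = q%:R^-1 *: e.
          by rewrite -sum_ab; apply: eq_bigr => l _; rewrite KC.
        rewrite sum_ab -!scalerAl -!scalerAr !linearZ /= mulrA -expr2.
        by rewrite -(zC e) -[z * e * e]mulrA ee.
      rewrite mulr_sumr linear_sum; apply: eq_bigr => l _; congr (tau _).
      rewrite !mulr_suml; apply: eq_bigr => j _.
      rewrite !mulrA; congr (_ * _); rewrite -!mulrA !zC.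
      by rewrite [b j * _]mulrA (KC (b j)) // -mulrA.
    apply: eq_bigr => l _.
    have -> : P (b l * z) = \sum_i tau (b l * z * t i) *: P (s i).
      under [RHS]eq_bigr => i _ do rewrite scaler_sumr.
      rewrite exchange_big; apply: eq_bigr => j _ /=.
      rewrite {1}(exps (b l * z)) mulr_sumr mulr_suml; apply: eq_bigr => i _.
      by rewrite -scalerAr -scalerAl.
    rewrite mulr_suml linear_sum; apply: eq_bigr => i _.
    by rewrite -scalerAl -scalerAr !linearZ /= mulrC -mulrA tauC.
  (* Second evaluation: C(a_j) is expanded over the center, [tauCZ] brings in c, and the sum over j
     is undone by expanding c al_k e, an element of K. *)
  under eq_bigr => j _.
    rewrite [C (a j)](expbe _ (CZ _)) mulr_sumr mulr_suml linear_sum.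
    under eq_bigr => k _ do rewrite -scalerAr -scalerAl linearZ /= tauCZ //.
    over.
  rewrite exchange_big /=.
  transitivity (\sum_k tau (z * c * e * (al k * be k))); last first.
    rewrite -linear_sum -mulr_sumr sum_albe -scalerAr linearZ /= mulr1.
    by [].
  apply: eq_bigr => k _.
  have /mem_centerP alC := alZ k; have /mem_centerP beC := beZ k.
  have cal_eK : c * al k * e \in K.
    apply: ZeK; apply/mem_centerP => y.
    by rewrite -mulrA alC mulrA -(cC y) -mulrA.
  have -> : z * c * e * (al k * be k) = z * be k * (c * al k * e).
    rewrite -!mulrA; congr (_ * _).
    rewrite [RHS]beC -!mulrA; congr (_ * _).
    by rewrite [RHS]alC -mulrA; congr (_ * _); rewrite alC.
  rewrite [in RHS](expb _ cal_eK) mulr_sumr linear_sum.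
  apply: eq_bigr => j _; rewrite -scalerAr linearZ /=; congr (tau _ * _).
  by rewrite (cC (a j)) -!mulrA eK1 // alC.
have Dc : c = (p%:R / q%:R ^+ 2)%:A.
  have cZ : c \in Z by apply/mem_centerP => y; rewrite cC.
  (* The central element w satisfies tau(z w e) = 0 for all central z. If it were invertible, taking
     z to be its inverse would give tau(e) = 0. *)
  pose w := q%:R^-1 ^+ 2 *: 1 - p%:R^-1 *: c.
  have wZ : w \in Z by rewrite memvB ?memvZ.
  have tau_w z : z \in Z -> tau (z * w * e) = 0.
    move=> zZ; rewrite mulrBr mulrBl -!scalerAr -!scalerAl linearB !linearZ /=.
    by rewrite mulr1 double_sum // subrr.
  have w0 : w = 0.
    apply/eqP; apply: contraT => w_neq0.
    have [y yZ wy] := center_division wZ w_neq0.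
    have /mem_centerP yC := yZ.
    have := tau_w y yZ; rewrite yC wy mul1r.
    by move/eqP; rewrite (negPf (tau_idempotent_neq0 char0 CH e_neq0 ee)).
  move/eqP: w0; rewrite subr_eq0 => /eqP w0.
  by rewrite -[LHS](scalerKV p_neq0) -w0 scalerA exprVn.
exists p, q, t; split=> //.
(* Applying [tau] to the Casimir sum of the center gives dim Z = m / p. *)
have := congr1 tau sum_albe; rewrite linear_sum linearZ /= tau1.
under eq_bigr => i _ do rewrite albe eqxx.
rewrite sumr_const card_ord => /(congr1 ( *%R p%:R)).
by rewrite mulVKf // -natrM => /natr_pchar0_inj.
Qed.

Lemma tau_reduced_trace : exists r : nat, (0 < r)%N /\
  m = (r * RA_degree S)%N /\ forall x : S, tau x = r%:R * reduced_trace x.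
Proof.
have [p [q [t [p_gt0 q_gt0 Dm exps Dc]]]] := casimir_scalar.
have oneZ : 1 \in Z by apply/mem_centerP => y; rewrite mul1r mulr1.
have dimZ_gt0 : (0 < \dim Z)%N.
  by rewrite lt0n dimv_eq0; apply: contraTneq oneZ => ->; rewrite memv0 oner_neq0.
have q_neq0 : q%:R != 0 :> F by move/pcharf0P: char0 => ->; rewrite -lt0n.
have trE x := trace_amull_dual x exps.
(* The trace of multiplication by 1 is dim S, while c = p / q^2 and m = p dim Z give tau(c) = p^2
   dim Z / q^2. *)
have eq_dim : (\dim {:S} * q ^ 2 = p ^ 2 * \dim Z)%N.
  apply: natr_pchar0_inj; rewrite natrM natrX.
  have := trE 1; rewrite amull1 passmx.mxof1; last exact: basis_free (vbasisP _).
  rewrite mxtrace1 Dc mul1r linearZ /= tau1 => ->.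
  by rewrite Dm mulrAC divfK ?expf_neq0 // -natrM mulnA.
have /dvdnP[M DM] : (\dim Z %| \dim {:S})%N.
  apply: dim_division_module => // [x y /mem_centerP xC /mem_centerP yC|x xZ x_neq0].
    by apply/mem_centerP => k; rewrite -mulrA yC mulrA xC mulrA.
  have [y yZ xy] := center_division xZ x_neq0.
  by exists y; rewrite // -xy; move/mem_centerP: xZ.
have DMq : (M * q ^ 2 = p ^ 2)%N.
  by apply/eqP; rewrite -(eqn_pmul2r dimZ_gt0) -eq_dim DM mulnAC.
(* Since q^2 divides p^2, n = p / q is an integer and dim S / dim Z = n^2; the truncated quotient
   and square root in [hk_deg] are therefore exact. *)
have /dvdnP[n Dp] : (q %| p)%N by rewrite -(@dvdn_pexp2r q p 2) // -DMq dvdn_mull.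
have DMn : M = (n * n)%N.
  apply/eqP; rewrite -(@eqn_pmul2r (q ^ 2)) ?expn_gt0 ?q_gt0 //.
  by rewrite DMq Dp expnMn mulnn.
have hkE : hk_deg S = n.
  rewrite /hk_deg /center_dim DM mulnK // DMn.
  exact: PeanoNat.Nat.sqrt_square.
have n_neq0 : n%:R != 0 :> F.
  by move/pcharf0P: char0 => ->; move: p_gt0; rewrite Dp muln_gt0 lt0n => /andP[].
exists q; split=> //; split=> [|x].
  by rewrite /RA_degree hkE Dm Dp /center_dim mulnCA mulnA.
rewrite /reduced_trace hkE trE Dc -scalerAr mulr1 linearZ /= Dp natrM.
by field; rewrite n_neq0 q_neq0.
Qed.

End MainIdentity.

(** * Extension of the trace from R to S *)

Theorem theorem4p2
  (R : nzRingType) (A : idomainType) (phi : {rmorphism A -> R})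
  (* R prime; A (via phi) a subring of the center of R *)
  (Rprime : prime_ring R)
  (phi_inj : injective phi)
  (phi_central : forall (a : A) (x : R), phi a * x = x * phi a)
  (* A integrally closed, char F = 0 where F = {fraction A} *)
  (Aic : integrally_closed A)
  (char0 : [pchar {fraction A}] =i pred0)
  (* R finitely generated A-module *)
  (Rfg : exists s : seq R, forall x : R,
           exists c : 'I_(size s) -> A, x = \sum_(i < size s) phi (c i) * s`_i)
  (* S = R (x)_A F, given as an F-algebra with an embedding j : R -> S *)
  (S : falgType {fraction A}) (j : {rmorphism R -> S})
  (j_inj : injective j)
  (j_scal : forall a : A, j (phi a) = (tofrac a)%:A)
  (j_gen : forall s : S, exists (x : R) (d : A), d != 0 /\ s = (tofrac d)^-1 *: j x)
  (* tau a trace with values in A *)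
  (tau : R -> A)
  (tau_lin : forall (a : A) (x y : R), tau (phi a * x + y) = a * tau x + tau y)
  (tau_comm : forall x y : R, tau (x * y) = tau (y * x))
  (tau_tau : forall x y : R, tau (phi (tau x) * y) = tau x * tau y)
  (* R is m-Cayley-Hamilton for tau *)
  (m : nat)
  (tau1 : tau 1 = m%:R)
  (CH : forall x : R, chi_eval m (fun i => tofrac (tau (x ^+ i))) (j x) = 0) :
  exists r : nat, (0 < r)%N /\ m = (r * RA_degree S)%N /\
    forall x : R, tofrac (tau x) = r%:R * reduced_trace (j x).
Proof.
have tof_neq0 (d : A) : d != 0 -> tofrac d != 0 by rewrite tofrac_eq0.
have jphi a x : j (phi a * x) = tofrac a *: j x.
  by rewrite rmorphM j_scal mulr_algl.
have tau0 : tau 0 = 0.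
  by have := tau_lin (-1) 0 0; rewrite mulr0 addr0 mulN1r addNr.
have tauZ a x : tau (phi a * x) = a * tau x.
  by have := tau_lin a x 0; rewrite tau0 !addr0.
have tauD x y : tau (x + y) = tau x + tau y.
  by have := tau_lin 1 x y; rewrite rmorph1 !mul1r.
have frac_rep (s : S) : exists xd : R * A,
    (xd.2 != 0) && (s == (tofrac xd.2)^-1 *: j xd.1).
  by have [x [d [d_neq0 ->]]] := j_gen s; exists (x, d); rewrite d_neq0 eqxx.
pose rep s := xchoose (frac_rep s).
pose tauS (s : S) := (tofrac (rep s).2)^-1 * tofrac (tau (rep s).1).
(* Independence of the chosen fraction: cross-multiplied numerators agree in R by injectivity of
   [j], and [tau] is A-linear. *)
have tauSE (d : A) (x : R) : d != 0 ->
    tauS ((tofrac d)^-1 *: j x) = (tofrac d)^-1 * tofrac (tau x).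
  move=> d_neq0; rewrite /tauS; set s := _ *: _.
  have := xchooseP (frac_rep s); rewrite -/(rep s).
  case: (rep s) => x' d' /= /andP[d'_neq0 /eqP Ds].
  have /j_inj eq_x : j (phi d' * x) = j (phi d * x').
    rewrite !jphi; have <- : tofrac d *: s = j x.
      by rewrite /s scalerA divff ?tof_neq0 // scale1r.
    by rewrite {1}Ds !scalerA mulrAC mulfV ?tof_neq0 // mul1r.
  have := congr1 (fun y => tofrac (tau y)) eq_x; rewrite /= !tauZ !tofracM => eq_tau.
  apply: (mulfI (tof_neq0 _ d_neq0)); apply: (mulfI (tof_neq0 _ d'_neq0)).
  by rewrite [LHS]mulrCA !mulVKf ?tof_neq0.
have tauSj x : tauS (j x) = tofrac (tau x).
  have := tauSE 1 x (oner_neq0 _).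
  by rewrite tofrac1 invr1 scale1r mul1r.
have tauS_lin : linear_for *%R tauS.
  move=> k s s'; have [x [d [d_neq0 ->]]] := j_gen s.
  have [x' [d' [d'_neq0 ->]]] := j_gen s'.
  have [n [v [v_neq0 ->]]] := fraction_quotient k.
  have [nv nd nd'] : [/\ tofrac v != 0, tofrac d != 0 & tofrac d' != 0].
    by rewrite !tof_neq0.
  have -> : tofrac n / tofrac v *: ((tofrac d)^-1 *: j x) + (tofrac d')^-1 *: j x'
      = (tofrac (v * d * d'))^-1 *: j (phi (n * d') * x + phi (v * d) * x').
    by rewrite common_denominator // rmorphD !jphi !tofracM.
  rewrite !tauSE ?mulf_neq0 // tauD !tauZ tofracD !tofracM.
  exact/esym/(common_denominator (V := {fraction A}^o)).
pose tauL : {scalar S} := HB.pack tauS (GRing.isLinear.Build _ S _ _ tauS tauS_lin).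
have tauL1 : tauL 1 = m%:R.
  by rewrite -(rmorph1 j) /= tauSj tau1 rmorph_nat.
have tauLC (s s' : S) : tauL (s * s') = tauL (s' * s).
  have [x [d [d_neq0 ->]]] := j_gen s; have [x' [d' [d'_neq0 ->]]] := j_gen s'.
  rewrite -!scalerAl -!scalerAr !linearZ /= -!rmorphM !tauSj tau_comm.
  exact: mulrCA.
have tauLCH (s : S) : chi_eval m (fun i => tauL (s ^+ i)) s = 0.
  have [x [d [d_neq0 ->]]] := j_gen s; set c := _^-1.
  (* By homogeneity the identity at c x is c^m times the identity at x, which holds in R. *)
  transitivity (chi_eval m (fun i => c ^+ i * tofrac (tau (x ^+ i))) (c *: j x)).
    rewrite !chi_evalE; apply: eq_bigr => k _; congr (_ *: _).
    apply: eq_P_coef => // i.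
    by rewrite exprZn linearZ /= -rmorphXn tauSj.
  by rewrite chi_eval_homogeneous // CH scaler0.
have Sprime : prime_algebra S.
  move=> s s'; have [x [d [d_neq0 ->]]] := j_gen s.
  have [x' [d' [d'_neq0 ->]]] := j_gen s' => s0.
  have [y||] := Rprime x x'; [|move=> ->|move=> ->].
  - apply: j_inj; rewrite !rmorphM rmorph0.
    have /eqP := s0 (j y); rewrite -scalerAr -!scalerAl !scaler_eq0 !invr_eq0.
    by rewrite !(negPf (tof_neq0 _ _)) //= => /eqP.
  - by left; rewrite rmorph0 scaler0.
  - by right; rewrite rmorph0 scaler0.
have [r [r_gt0 [Dm tauE]]] := tau_reduced_trace char0 tauLCH tauL1 tauLC Sprime.
by exists r; split=> //; split=> // x; rewrite -tauE /= tauSj.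
Qed.
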